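(* For any composable pair of morphisms of schemes $X\xrightarrow fY\xrightarrow gZ$, the two composite natural transformations $$T_{-/X}\circ f^*\circ g^*\xRightarrow{{}_fT^{-1}\ast g^*}f^*\circ T_{-/Y}\circ g^*\xRightarrow{f^*\ast{}_gT^{-1}}f^*\circ g^*\circ T_{-/Z}\xRightarrow{\phi_{f,g}\ast T_{-/Z}}(g\circ f)^*\circ T_{-/Z}$$ and $$T_{-/X}\circ f^*\circ g^*\xRightarrow{T_{-/X}\ast\phi_{f,g}}T_{-/X}\circ(g\circ f)^*\xRightarrow{{}_{g\circ f}T^{-1}}(g\circ f)^*\circ T_{-/Z}$$ of functors $\mathbf{Sch}_{/Z}\to\mathbf{Sch}_{/X}$ are equal. In particular, the functors $T_{-/X}$ and the isomorphisms ${}_fT^{-1}$ describe the data of a pseudonatural transformation $T:\mathbf{Sch}_{/-}\Rightarrow\mathbf{Sch}_{/-}:\mathbf{Sch}^{\mathrm{op}}\to\mathbf{Cat}$.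
   Context: $\mathbf{Sch}_{/-}:\mathbf{Sch}^{\mathrm{op}}\to\mathbf{Cat}$ is the pseudofunctor $X\mapsto\mathbf{Sch}_{/X}$, $(f:X\to Y)\mapsto f^*:\mathbf{Sch}_{/Y}\to\mathbf{Sch}_{/X}$, $f^*W=W\times_YX$, with compositors $\phi_{f,g}:f^*\circ g^*\Rightarrow(g\circ f)^*$ given by the canonical isomorphisms $(W\times_ZY)\times_YX\cong W\times_Z(Y\times_YX)\cong W\times_ZX$. For an $S$-scheme $W$, $T_{W/S}=\underline{\mathrm{Spec}}_W(\mathrm{Sym}(\Omega^1_{W/S}))$; this gives the (Zariski) tangent functor $T_{-/S}:\mathbf{Sch}_{/S}\to\mathbf{Sch}_{/S}$. For $f:X\to Y$, ${}_fT:f^*\circ T_{-/Y}\Rightarrow T_{-/X}\circ f^*$ is the natural isomorphism with components the canonical isomorphisms $T_{W/Y}\times_YX\cong T_{W\times_YX/X}$; for $X=\mathrm{Spec}A$, $Y=\mathrm{Spec}C$, $W=\mathrm{Spec}B$ it is dual to the ring isomorphism $\mathrm{Sym}(\Omega^1_{B\otimes_CA/A})\to\mathrm{Sym}(\Omega^1_{B/C})\otimes_CA$, $b\otimes a\mapsto b\otimes a$, $\mathrm d(b\otimes a)\mapsto\mathrm db\otimes a$. *)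

(* Defs.v *)
From HB Require Import structures.
From mathcomp Require Import all_boot all_order all_algebra.
From mathcomp Require Import all_classical topology.
Set Implicit Arguments.
Unset Strict Implicit.
Unset Printing Implicit Defensive.
Import GRing.Theory.
Local Open Scope classical_set_scope.
Local Open Scope ring_scope.

Record category := Category {
  ob :> Type;
  hom : ob -> ob -> Type;
  idm : forall x, hom x x;
  comp : forall x y z, hom y z -> hom x y -> hom x z;
  comp1m : forall x y (f : hom x y), comp (idm y) f = f;
  compm1 : forall x y (f : hom x y), comp f (idm x) = f;
  compA : forall x y z t (h : hom z t) (g : hom y z) (f : hom x y),
    comp h (comp g f) = comp (comp h g) f
}.
Arguments hom {c} x y.
Arguments idm {c} x.
Arguments comp {c x y z} g f.
Notation "g \o_c f" := (comp g f) (at level 50, left associativity).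

(* The functor laws are kept apart from the functor data, and natural
   transformations only refer to the data: composition of functor data is
   then associative up to conversion, and no associators are needed. *)
Record functor_data (C D : category) := FunctorData {
  fob :> ob C -> ob D;
  fmap : forall x y : C, hom x y -> hom (fob x) (fob y)
}.
Arguments fmap {C D} f {x y} _.

Record functor (C D : category) := Functor {
  fdata :> functor_data C D;
  fmap_id : forall x : C, fmap fdata (idm x) = idm (fdata x);
  fmap_comp : forall (x y z : C) (g : hom y z) (f : hom x y),
    fmap fdata (g \o_c f) = fmap fdata g \o_c fmap fdata f
}.

Definition idF_data (C : category) : functor_data C C :=
  @FunctorData C C (fun x => x) (fun x y f => f).

Definition compF_data (C D E : category) (G : functor_data D E)
    (F : functor_data C D) : functor_data C E :=
  @FunctorData C E (fun x => G (F x)) (fun x y f => fmap G (fmap F f)).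
Notation "G \o_F F" := (compF_data G F) (at level 50, left associativity).

Record nat_trans (C D : category) (F G : functor_data C D) := NatTrans {
  ncomp :> forall x : C, hom (F x) (G x);
  naturality : forall (x y : C) (f : hom x y),
    fmap G f \o_c ncomp x = ncomp y \o_c fmap F f
}.

Record nat_iso (C D : category) (F G : functor_data C D) := NatIso {
  iso_fwd :> nat_trans F G;
  iso_inv : nat_trans G F;
  iso_fwdK : forall x, iso_inv x \o_c iso_fwd x = idm (F x);
  iso_invK : forall x, iso_fwd x \o_c iso_inv x = idm (G x)
}.

Section NatTransOps.
Variables C D E : category.

Lemma vcomp_subproof (F G H : functor_data C D) (b : nat_trans G H)
    (a : nat_trans F G) (x y : C) (f : hom x y) :
  fmap H f \o_c (b x \o_c a x) = (b y \o_c a y) \o_c fmap F f.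
Proof. by rewrite compA naturality -compA naturality compA. Qed.

Definition vcomp (F G H : functor_data C D) (b : nat_trans G H)
    (a : nat_trans F G) : nat_trans F H :=
  @NatTrans C D F H (fun x => b x \o_c a x) (vcomp_subproof b a).

Lemma whiskerl_subproof (H : functor D E) (F G : functor_data C D)
    (a : nat_trans F G) (x y : C) (f : hom x y) :
  fmap (H \o_F G) f \o_c fmap H (a x) = fmap H (a y) \o_c fmap (H \o_F F) f.
Proof. by rewrite /= -!fmap_comp naturality. Qed.

Definition whiskerl (H : functor D E) (F G : functor_data C D)
    (a : nat_trans F G) : nat_trans (H \o_F F) (H \o_F G) :=
  @NatTrans C E (H \o_F F) (H \o_F G) (fun x => fmap H (a x))
    (whiskerl_subproof H a).

Lemma whiskerr_subproof (F G : functor_data D E) (a : nat_trans F G)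
    (K : functor_data C D) (x y : C) (f : hom x y) :
  fmap (G \o_F K) f \o_c a (K x) = a (K y) \o_c fmap (F \o_F K) f.
Proof. exact: naturality. Qed.

Definition whiskerr (F G : functor_data D E) (a : nat_trans F G)
    (K : functor_data C D) : nat_trans (F \o_F K) (G \o_F K) :=
  @NatTrans C E (F \o_F K) (G \o_F K) (fun x => a (K x))
    (whiskerr_subproof a K).

End NatTransOps.

Notation "b \o_v a" := (vcomp b a) (at level 50, left associativity).
Notation "H \wl a" := (whiskerl H a) (at level 40).
Notation "a \wr K" := (whiskerr a K) (at level 40).

(* In a pseudofunctor C^op -> Cat with C a 1-category, the coherence laws
   involve the identity 2-cells between the images of equal morphisms of C;
   these are the [eq_cell]s. *)
Definition eq_cell (C : category) (F : C -> category)
    (Fm : forall X Y : C, hom X Y -> functor (F Y) (F X))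
    (X Y : C) (f g : hom X Y) (e : f = g) (x : F Y) :
    hom (Fm X Y f x) (Fm X Y g x) :=
  match e in _ = g' return hom (Fm X Y f x) (Fm X Y g' x) with
  | erefl => idm (Fm X Y f x)
  end.

Record pseudofunctor (C : category) := Pseudofunctor {
  pf_cat :> C -> category;
  pf_map : forall X Y : C, hom X Y -> functor (pf_cat Y) (pf_cat X);
  pf_id : forall X : C, nat_iso (idF_data (pf_cat X)) (pf_map (idm X));
  pf_comp : forall (X Y Z : C) (f : hom X Y) (g : hom Y Z),
    nat_iso (pf_map f \o_F pf_map g) (pf_map (g \o_c f));
  pf_assoc : forall (X Y Z V : C) (f : hom X Y) (g : hom Y Z) (h : hom Z V)
      (x : pf_cat V),
    eq_cell pf_map (compA h g f) x
      \o_c (pf_comp (g \o_c f) h x \o_c pf_comp f g (pf_map h x))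
    = pf_comp f (h \o_c g) x \o_c fmap (pf_map f) (pf_comp g h x);
  pf_unitl : forall (X Y : C) (f : hom X Y) (x : pf_cat Y),
    eq_cell pf_map (compm1 f) x
      \o_c (pf_comp (idm X) f x \o_c pf_id X (pf_map f x))
    = idm (pf_map f x);
  pf_unitr : forall (X Y : C) (f : hom X Y) (x : pf_cat Y),
    eq_cell pf_map (comp1m f) x
      \o_c (pf_comp f (idm Y) x \o_c fmap (pf_map f) (pf_id Y x))
    = idm (pf_map f x)
}.

Record pseudonatural (C : category) (P Q : pseudofunctor C)
    (t : forall X : C, functor (P X) (Q X))
    (c : forall (X Y : C) (f : hom X Y),
      nat_trans (t X \o_F pf_map P f) (pf_map Q f \o_F t Y)) : Prop :=
  Pseudonatural {
  pn_iso : forall (X Y : C) (f : hom X Y) (x : P Y), exists d,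
    d \o_c c X Y f x = idm _ /\ c X Y f x \o_c d = idm _;
  pn_comp : forall (X Y Z : C) (f : hom X Y) (g : hom Y Z),
    (pf_comp Q f g \wr t Z)
      \o_v ((pf_map Q f \wl c Y Z g) \o_v (c X Y f \wr pf_map P g))
    = c X Z (g \o_c f) \o_v (t X \wl pf_comp P f g);
  pn_id : forall X : C,
    c X X (idm X) \o_v (t X \wl pf_id P X)
    = pf_id Q X \wr t X :> nat_trans (t X \o_F idF_data (P X)) _
}.


Record slice_ob (C : category) (S : C) := SliceOb {
  sdom :> C;
  sstr : hom sdom S
}.
Arguments sstr {C S} s.

Record slice_hom (C : category) (S : C) (W W' : slice_ob S) := SliceHom {
  smor :> hom W W';
  smorE : sstr W' \o_c smor = sstr W
}.

Section Slice.
Variables (C : category) (S : C).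

Lemma slice_hom_eq (W W' : slice_ob S) (f g : slice_hom W W') :
  smor f = smor g -> f = g.
Proof.
case: f g => [f ef] [g eg] /= e; case: _ / e in eg *.
by rewrite (Prop_irrelevance ef eg).
Qed.

Definition slice_id (W : slice_ob S) : slice_hom W W :=
  SliceHom (compm1 (sstr W)).

Lemma slice_comp_subproof (W1 W2 W3 : slice_ob S) (g : slice_hom W2 W3)
    (f : slice_hom W1 W2) : sstr W3 \o_c (smor g \o_c smor f) = sstr W1.
Proof. by rewrite compA !smorE. Qed.

Definition slice_comp (W1 W2 W3 : slice_ob S) (g : slice_hom W2 W3)
    (f : slice_hom W1 W2) : slice_hom W1 W3 :=
  SliceHom (slice_comp_subproof g f).

Lemma slice_comp1m (W W' : slice_ob S) (f : slice_hom W W') :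
  slice_comp (slice_id W') f = f.
Proof. by apply: slice_hom_eq; apply: comp1m. Qed.

Lemma slice_compm1 (W W' : slice_ob S) (f : slice_hom W W') :
  slice_comp f (slice_id W) = f.
Proof. by apply: slice_hom_eq; apply: compm1. Qed.

Lemma slice_compA (W1 W2 W3 W4 : slice_ob S) (h : slice_hom W3 W4)
    (g : slice_hom W2 W3) (f : slice_hom W1 W2) :
  slice_comp h (slice_comp g f) = slice_comp (slice_comp h g) f.
Proof. by apply: slice_hom_eq; apply: compA. Qed.

Definition slice : category :=
  Category slice_comp1m slice_compm1 slice_compA.

End Slice.

Record pullbacks (C : category) := Pullbacks {
  pb : forall (X Y S : C) (f : hom X S) (g : hom Y S), C;
  pb1 : forall (X Y S : C) (f : hom X S) (g : hom Y S), hom (pb f g) X;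
  pb2 : forall (X Y S : C) (f : hom X S) (g : hom Y S), hom (pb f g) Y;
  pb_comm : forall (X Y S : C) (f : hom X S) (g : hom Y S),
    f \o_c pb1 f g = g \o_c pb2 f g;
  pb_lift : forall (X Y S : C) (f : hom X S) (g : hom Y S) (V : C)
    (u : hom V X) (v : hom V Y), f \o_c u = g \o_c v -> hom V (pb f g);
  pb_lift1 : forall (X Y S : C) (f : hom X S) (g : hom Y S) (V : C)
    (u : hom V X) (v : hom V Y) (e : f \o_c u = g \o_c v),
    pb1 f g \o_c pb_lift e = u;
  pb_lift2 : forall (X Y S : C) (f : hom X S) (g : hom Y S) (V : C)
    (u : hom V X) (v : hom V Y) (e : f \o_c u = g \o_c v),
    pb2 f g \o_c pb_lift e = v;
  pb_uniq : forall (X Y S : C) (f : hom X S) (g : hom Y S) (V : C)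
    (u v : hom V (pb f g)), pb1 f g \o_c u = pb1 f g \o_c v ->
    pb2 f g \o_c u = pb2 f g \o_c v -> u = v
}.
Arguments pb {C} p {X Y S} f g.
Arguments pb1 {C} p {X Y S} f g.
Arguments pb2 {C} p {X Y S} f g.

Section SlicePseudofunctor.
Variables (C : category) (PB : pullbacks C).

Section BaseChange.
Variables (X Y : C) (f : hom X Y).

Definition bc_ob (W : slice Y) : slice X := SliceOb (pb2 PB (sstr W) f).

Lemma bc_hom_subproof (W W' : slice Y) (h : hom W W') :
  sstr W' \o_c (smor h \o_c pb1 PB (sstr W) f) = f \o_c pb2 PB (sstr W) f.
Proof. by rewrite compA smorE pb_comm. Qed.

Definition bc_hom (W W' : slice Y) (h : hom W W') :
    hom (bc_ob W) (bc_ob W') :=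
  @SliceHom C X (bc_ob W) (bc_ob W') (pb_lift PB (bc_hom_subproof h))
    (pb_lift2 PB (bc_hom_subproof h)).

Definition bc_data : functor_data (slice Y) (slice X) := FunctorData bc_hom.

Lemma bc_id (W : slice Y) : fmap bc_data (idm W) = idm (bc_data W).
Proof.
apply: slice_hom_eq; apply: pb_uniq.
  by rewrite pb_lift1 /= comp1m compm1.
by rewrite pb_lift2 /= compm1.
Qed.

Lemma bc_comp (W1 W2 W3 : slice Y) (h : hom W2 W3) (g : hom W1 W2) :
  fmap bc_data (h \o_c g) = fmap bc_data h \o_c fmap bc_data g.
Proof.
apply: slice_hom_eq; apply: pb_uniq => /=.
  by rewrite pb_lift1 compA pb_lift1 -!compA pb_lift1.
by rewrite pb_lift2 compA !pb_lift2.
Qed.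

Definition base_change : functor (slice Y) (slice X) :=
  Functor bc_id bc_comp.

End BaseChange.

Lemma bc_eq_cell1 (X Y : C) (f g : hom X Y) (e : f = g) (W : slice Y) :
  pb1 PB (sstr W) g \o_c smor (eq_cell base_change e W) = pb1 PB (sstr W) f.
Proof. by case: _ / e; rewrite /= compm1. Qed.

Lemma bc_eq_cell2 (X Y : C) (f g : hom X Y) (e : f = g) (W : slice Y) :
  pb2 PB (sstr W) g \o_c smor (eq_cell base_change e W) = pb2 PB (sstr W) f.
Proof. by case: _ / e; rewrite /= compm1. Qed.

(* The canonical isomorphism (W x_Z Y) x_Y X -> W x_Z X is characterized by its
   compatibility with the projections to W and to X. *)
Section Compositor.
Variables (X Y Z : C) (f : hom X Y) (g : hom Y Z).

Lemma phi_subproof (W : slice Z) :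
  sstr W \o_c (pb1 PB (sstr W) g \o_c pb1 PB (pb2 PB (sstr W) g) f)
  = (g \o_c f) \o_c pb2 PB (pb2 PB (sstr W) g) f.
Proof. by rewrite compA pb_comm -compA pb_comm compA. Qed.

Definition phi_comp (W : slice Z) :
    hom ((base_change f \o_F base_change g) W) (base_change (g \o_c f) W) :=
  @SliceHom C X (bc_ob f (bc_ob g W)) (bc_ob (g \o_c f) W)
    (pb_lift PB (phi_subproof W)) (pb_lift2 PB (phi_subproof W)).

Lemma phi_inv_subproof1 (W : slice Z) :
  sstr W \o_c pb1 PB (sstr W) (g \o_c f)
  = g \o_c (f \o_c pb2 PB (sstr W) (g \o_c f)).
Proof. by rewrite compA pb_comm. Qed.

Lemma phi_inv_subproof2 (W : slice Z) :
  pb2 PB (sstr W) g \o_c pb_lift PB (phi_inv_subproof1 W)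
  = f \o_c pb2 PB (sstr W) (g \o_c f).
Proof. by rewrite pb_lift2. Qed.

Definition phi_inv_comp (W : slice Z) :
    hom (base_change (g \o_c f) W) ((base_change f \o_F base_change g) W) :=
  @SliceHom C X (bc_ob (g \o_c f) W) (bc_ob f (bc_ob g W))
    (pb_lift PB (phi_inv_subproof2 W)) (pb_lift2 PB (phi_inv_subproof2 W)).

Lemma phi_natural (W W' : slice Z) (h : hom W W') :
  fmap (base_change (g \o_c f)) h \o_c phi_comp W
  = phi_comp W' \o_c fmap (base_change f \o_F base_change g) h.
Proof.
apply: slice_hom_eq; apply: pb_uniq; rewrite /= !compA.
  by rewrite !pb_lift1 -!compA !pb_lift1 !compA pb_lift1.
by rewrite !pb_lift2.
Qed.

Lemma phi_inv_natural (W W' : slice Z) (h : hom W W') :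
  fmap (base_change f \o_F base_change g) h \o_c phi_inv_comp W
  = phi_inv_comp W' \o_c fmap (base_change (g \o_c f)) h.
Proof.
apply: slice_hom_eq; apply: pb_uniq; rewrite /= !compA; last first.
  by rewrite !pb_lift2.
rewrite !pb_lift1 -!compA pb_lift1; apply: pb_uniq; rewrite !compA.
  by rewrite !pb_lift1 -!compA pb_lift1.
by rewrite !pb_lift2 -compA pb_lift2.
Qed.

Lemma phiK (W : slice Z) : phi_inv_comp W \o_c phi_comp W = idm _.
Proof.
apply: slice_hom_eq; apply: pb_uniq; rewrite /= compm1 compA; last first.
  by rewrite !pb_lift2.
rewrite pb_lift1; apply: pb_uniq; rewrite compA.
  by rewrite !pb_lift1.
by rewrite pb_lift2 -compA pb_lift2 pb_comm.
Qed.

Lemma phi_invK (W : slice Z) : phi_comp W \o_c phi_inv_comp W = idm _.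
Proof.
apply: slice_hom_eq; apply: pb_uniq; rewrite /= compm1 compA.
  by rewrite pb_lift1 -compA !pb_lift1.
by rewrite !pb_lift2.
Qed.

Definition phi : nat_iso (base_change f \o_F base_change g)
    (base_change (g \o_c f)) :=
  @NatIso _ _ _ (base_change (g \o_c f)) (NatTrans phi_natural)
    (NatTrans phi_inv_natural) phiK phi_invK.

End Compositor.

Section Unitor.
Variable X : C.

Lemma unitor_subproof (W : slice X) :
  sstr W \o_c idm (sdom W) = idm X \o_c sstr W.
Proof. by rewrite comp1m compm1. Qed.

Definition unitor_comp (W : slice X) : hom W (base_change (idm X) W) :=
  @SliceHom C X W (bc_ob (idm X) W)
    (pb_lift PB (unitor_subproof W)) (pb_lift2 PB (unitor_subproof W)).

Lemma unitor_inv_subproof (W : slice X) :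
  sstr W \o_c pb1 PB (sstr W) (idm X) = pb2 PB (sstr W) (idm X).
Proof. by rewrite pb_comm comp1m. Qed.

Definition unitor_inv_comp (W : slice X) : hom (base_change (idm X) W) W :=
  @SliceHom C X (bc_ob (idm X) W) W
    (pb1 PB (sstr W) (idm X)) (unitor_inv_subproof W).

Lemma unitor_natural (W W' : slice X) (h : hom W W') :
  fmap (base_change (idm X)) h \o_c unitor_comp W
  = unitor_comp W' \o_c fmap (idF_data (slice X)) h.
Proof.
apply: slice_hom_eq; apply: pb_uniq; rewrite /= !compA.
  by rewrite !pb_lift1 -compA pb_lift1 compm1 comp1m.
by rewrite !pb_lift2 smorE.
Qed.

Lemma unitor_inv_natural (W W' : slice X) (h : hom W W') :
  fmap (idF_data (slice X)) h \o_c unitor_inv_comp W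
  = unitor_inv_comp W' \o_c fmap (base_change (idm X)) h.
Proof. by apply: slice_hom_eq; rewrite /= pb_lift1. Qed.

Lemma unitorK (W : slice X) :
  unitor_inv_comp W \o_c unitor_comp W = idm W.
Proof. by apply: slice_hom_eq; rewrite /= pb_lift1. Qed.

Lemma unitor_invK (W : slice X) :
  unitor_comp W \o_c unitor_inv_comp W = idm _.
Proof.
apply: slice_hom_eq; apply: pb_uniq; rewrite /= compm1 compA.
  by rewrite pb_lift1 comp1m.
by rewrite pb_lift2 unitor_inv_subproof.
Qed.

Definition unitor : nat_iso (idF_data (slice X)) (base_change (idm X)) :=
  @NatIso _ _ (idF_data (slice X)) (base_change (idm X))
    (@NatTrans _ _ (idF_data (slice X)) _ unitor_comp unitor_natural)
    (@NatTrans _ _ _ (idF_data (slice X)) unitor_inv_comp unitor_inv_natural)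
    unitorK unitor_invK.

End Unitor.

Lemma slice_pf_assoc (X Y Z V : C) (f : hom X Y) (g : hom Y Z) (h : hom Z V)
    (W : slice V) :
  eq_cell base_change (compA h g f) W
    \o_c (phi (g \o_c f) h W \o_c phi f g (base_change h W))
  = phi f (h \o_c g) W \o_c fmap (base_change f) (phi g h W).
Proof.
apply: slice_hom_eq; apply: pb_uniq; rewrite /= !compA.
  rewrite bc_eq_cell1 [RHS]compA !pb_lift1 -[LHS]compA pb_lift1.
  by rewrite -[RHS]compA pb_lift1 [RHS]compA pb_lift1 [LHS]compA.
by rewrite bc_eq_cell2 [RHS]compA !pb_lift2.
Qed.

Lemma slice_pf_unitl (X Y : C) (f : hom X Y) (W : slice Y) :
  eq_cell base_change (compm1 f) W
    \o_c (phi (idm X) f W \o_c unitor X (base_change f W))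
  = idm (base_change f W).
Proof.
apply: slice_hom_eq; apply: pb_uniq; rewrite /= !compA [RHS]compm1.
  by rewrite bc_eq_cell1 pb_lift1 -compA pb_lift1 compm1.
by rewrite bc_eq_cell2 ?compA !pb_lift2.
Qed.

Lemma slice_pf_unitr (X Y : C) (f : hom X Y) (W : slice Y) :
  eq_cell base_change (comp1m f) W
    \o_c (phi f (idm Y) W \o_c fmap (base_change f) (unitor Y W))
  = idm (base_change f W).
Proof.
apply: slice_hom_eq; apply: pb_uniq; rewrite /= !compA [RHS]compm1.
  by rewrite bc_eq_cell1 pb_lift1 -compA pb_lift1 compA pb_lift1 comp1m.
by rewrite bc_eq_cell2 ?compA !pb_lift2.
Qed.

Definition slice_pf : pseudofunctor C :=
  @Pseudofunctor C (fun X => slice X) base_change unitor phi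
    slice_pf_assoc slice_pf_unitl slice_pf_unitr.

End SlicePseudofunctor.

Record opens (X : topologicalType) := Opens {
  oset :> set X;
  osetP : open oset
}.

Definition preim (X Y : topologicalType) (f : X -> Y) (cf : continuous f)
    (U : opens Y) : opens X :=
  Opens (open_comp (fun x _ => cf x) (osetP U)).

Definition is_sheaf (X : topologicalType) (F : opens X -> Type)
    (r : forall U V : opens X, V `<=` U -> F U -> F V) : Prop :=
  forall (I : Type) (U : opens X) (V : I -> opens X)
    (VU : forall i, V i `<=` U), U `<=` \bigcup_i V i ->
  forall s : forall i, F (V i),
    (forall i j (W : opens X) (Wi : W `<=` V i) (Wj : W `<=` V j),
      r _ _ Wi (s i) = r _ _ Wj (s j)) ->
  exists! t : F U, forall i, r _ _ (VU i) t = s i.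

(* Rings are commutative and unital, possibly zero (as over the empty set). *)
Record ring_sheaf (X : topologicalType) := RingSheaf {
  sec :> opens X -> comPzRingType;
  res : forall U V : opens X, V `<=` U -> {rmorphism sec U -> sec V};
  res_id : forall (U : opens X) (UU : U `<=` U) (s : sec U), res UU s = s;
  res_comp : forall (U V W : opens X) (VU : V `<=` U) (WV : W `<=` V)
    (WU : W `<=` U) (s : sec U), res WV (res VU s) = res WU s;
  ring_sheafP : is_sheaf (fun U V VU => res VU : sec U -> sec V)
}.
Arguments res {X r U V} _.

Record ring_sheaf_hom (X : topologicalType) (F G : ring_sheaf X) :=
  RingSheafHom {
  rsh :> forall U : opens X, {rmorphism F U -> G U};
  rsh_res : forall (U V : opens X) (VU : V `<=` U) (s : F U),
    res VU (rsh U s) = rsh V (res VU s)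
}.

Section DirectImage.
Variables (X Y : topologicalType) (f : X -> Y) (cf : continuous f).
Variable F : ring_sheaf X.

Lemma preim_subset (U V : opens Y) : V `<=` U -> preim cf V `<=` preim cf U.
Proof. by move=> VU x; apply: VU. Qed.

Lemma direct_image_sheafP :
  @is_sheaf Y (fun U => F (preim cf U))
    (fun U V VU => res (preim_subset VU)).
Proof.
move=> I U V VU UV s ss.
apply: (@ring_sheafP _ F I (preim cf U) (fun i => preim cf (V i))
  (fun i => preim_subset (VU i))) => [x /UV[i _ ?]|i j W Wi Wj].
  by exists i.
pose Vij := Opens (openI (osetP (V i)) (osetP (V j))).
have Vi : Vij `<=` V i by move=> y [].
have Vj : Vij `<=` V j by move=> y [].
have WV : W `<=` preim cf Vij by move=> x Wx; split; [apply: Wi|apply: Wj].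
have := congr1 (res WV) (ss i j Vij Vi Vj).
by rewrite !(res_comp _ _ Wi) !(res_comp _ _ Wj).
Qed.

Definition direct_image : ring_sheaf Y :=
  @RingSheaf Y (fun U => F (preim cf U)) (fun U V VU => res (preim_subset VU))
    (fun U UU s => res_id (preim_subset UU) s)
    (fun U V W VU WV WU s =>
       res_comp (preim_subset VU) (preim_subset WV) (preim_subset WU) s)
    direct_image_sheafP.

End DirectImage.

Record module_sheaf (X : topologicalType) (O : ring_sheaf X) := ModuleSheaf {
  msec :> forall U : opens X, lmodType (O U);
  mres : forall U V : opens X, V `<=` U -> msec U -> msec V;
  mresD : forall (U V : opens X) (VU : V `<=` U) (m n : msec U),
    mres VU (m + n) = mres VU m + mres VU n;
  mresZ : forall (U V : opens X) (VU : V `<=` U) (a : O U) (m : msec U),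
    mres VU (a *: m) = res VU a *: mres VU m;
  mres_id : forall (U : opens X) (UU : U `<=` U) (m : msec U), mres UU m = m;
  mres_comp : forall (U V W : opens X) (VU : V `<=` U) (WV : W `<=` V)
    (WU : W `<=` U) (m : msec U), mres WV (mres VU m) = mres WU m;
  module_sheafP : is_sheaf (fun U V VU => @mres U V VU)
}.
Arguments mres {X O m0 U V} _ _.

Record module_sheaf_hom (X : topologicalType) (O : ring_sheaf X)
    (M N : module_sheaf O) := ModuleSheafHom {
  msh :> forall U : opens X, {linear M U -> N U};
  msh_res : forall (U V : opens X) (VU : V `<=` U) (m : M U),
    mres VU (msh U m) = msh V (mres VU m)
}.

Record algebra_sheaf (X : topologicalType) (O : ring_sheaf X) :=
  AlgebraSheaf {
  alg_ring :> ring_sheaf X;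
  alg_struct : ring_sheaf_hom O alg_ring
}.
Arguments alg_struct {X O} a.

Record algebra_sheaf_hom (X : topologicalType) (O : ring_sheaf X)
    (A B : algebra_sheaf O) := AlgebraSheafHom {
  ash :> ring_sheaf_hom A B;
  ash_struct : forall (U : opens X) (a : O U),
    ash U (alg_struct A U a) = alg_struct B U a
}.

Section AlgebraModule.
Variables (X : topologicalType) (O : ring_sheaf X) (A : algebra_sheaf O).

Definition alg_sec (U : opens X) : Type := A U.
HB.instance Definition _ (U : opens X) := GRing.Zmodule.on (alg_sec U).

Definition alg_scale (U : opens X) (a : O U) (m : alg_sec U) : alg_sec U :=
  alg_struct A U a * (m : A U).

Fact alg_scaleA (U : opens X) (a b : O U) (m : alg_sec U) :
  alg_scale a (alg_scale b m) = alg_scale (a * b) m.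
Proof. by rewrite /alg_scale rmorphM mulrA. Qed.

Fact alg_scale1 (U : opens X) : left_id 1 (@alg_scale U).
Proof. by move=> m; rewrite /alg_scale rmorph1 mul1r. Qed.

Fact alg_scaleDr (U : opens X) : right_distributive (@alg_scale U) +%R.
Proof. by move=> a m n; rewrite /alg_scale mulrDr. Qed.

Fact alg_scaleDl (U : opens X) (m : alg_sec U) :
  {morph (@alg_scale U)^~ m : a b / a + b}.
Proof. by move=> a b; rewrite /alg_scale rmorphD mulrDl. Qed.

HB.instance Definition _ (U : opens X) :=
  GRing.Zmodule_isLmodule.Build (O U) (alg_sec U)
    (@alg_scaleA U) (@alg_scale1 U) (@alg_scaleDr U) (@alg_scaleDl U).

Lemma alg_resZ (U V : opens X) (VU : V `<=` U) (a : O U) (m : alg_sec U) :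
  res VU (a *: m : alg_sec U) = res VU a *: (res VU m : alg_sec V).
Proof. by rewrite [LHS]rmorphM rsh_res. Qed.

Definition algebra_module : module_sheaf O :=
  @ModuleSheaf X O (fun U => alg_sec U) (fun U V VU => res VU)
    (fun U V VU m n => rmorphD (res VU) m n) alg_resZ
    (fun U UU m => res_id UU m) (fun U V W VU WV WU m => res_comp VU WV WU m)
    (@ring_sheafP X A).

End AlgebraModule.

(* The germ of s at x is a unit of the stalk. *)
Definition germ_unit (X : topologicalType) (F : ring_sheaf X) (U : opens X)
    (s : F U) (x : X) : Prop :=
  exists (V : opens X) (VU : V `<=` U), oset V x /\ exists t, res VU s * t = 1.

(* The stalks are local rings: they are nonzero, and in each of them a sum of
   two nonunits is a nonunit. *)
Record locally_ringed (X : topologicalType) (F : ring_sheaf X) : Prop :=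
  LocallyRinged {
  stalk_neq0 : forall (x : X) (U : opens X), oset U x -> (1 : F U) <> 0;
  stalk_local : forall (x : X) (U : opens X) (s t : F U), oset U x ->
    germ_unit (s + t) x -> germ_unit s x \/ germ_unit t x
}.

Record is_prime_ideal (A : comPzRingType) (P : set A) : Prop := IsPrimeIdeal {
  prime_ideal0 : P 0;
  prime_idealD : forall a b, P a -> P b -> P (a + b);
  prime_idealM : forall a b, P b -> P (a * b);
  prime_ideal_proper : ~ P 1;
  prime_ideal_prime : forall a b, P (a * b) -> P a \/ P b
}.

(* f exhibits B as the localization A[1/a]. *)
Record is_localization (A B : comPzRingType) (f : A -> B) (a : A) : Prop :=
  IsLocalization {
  loc_unit : exists b, f a * b = 1;
  loc_frac : forall b, exists n r, b * f a ^+ n = f r;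
  loc_ker : forall r, f r = 0 -> exists n, a ^+ n * r = 0
}.

(* h identifies the ringed space (U, F|_U) with Spec A, a point x
   corresponding to the prime ideal of those a whose germ at x is not a unit:
   - this is a bijection of U onto the set of prime ideals of A;
   - it is a homeomorphism for the Zariski topology, i.e. the sets
     D(a) = {x in U | a is a unit at x}, which are always open, form a basis;
   - the sections over D(a) are the localization A[1/a]. *)
Record is_spec (X : topologicalType) (F : ring_sheaf X) (U : opens X)
    (A : comPzRingType) (h : {rmorphism A -> F U}) : Prop := IsSpec {
  spec_prime : forall x, oset U x ->
    is_prime_ideal [set a | ~ germ_unit (h a) x];
  spec_inj : forall x y, oset U x -> oset U y ->
    (forall a, germ_unit (h a) x <-> germ_unit (h a) y) -> x = y;
  spec_surj : forall P : set A, is_prime_ideal P ->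
    exists x, oset U x /\ P = [set a | ~ germ_unit (h a) x];
  spec_basis : forall V : opens X, V `<=` U -> forall x, oset V x ->
    exists a, germ_unit (h a) x /\
      forall y, oset U y -> germ_unit (h a) y -> oset V y;
  spec_sections : forall (a : A) (V : opens X) (VU : V `<=` U),
    (forall x, oset U x -> oset V x <-> germ_unit (h a) x) ->
    is_localization (fun r => res VU (h r)) a
}.

Definition affine_open (X : topologicalType) (F : ring_sheaf X)
    (U : opens X) : Prop :=
  exists (A : comPzRingType) (h : {rmorphism A -> F U}), is_spec h.

Record scheme := Scheme {
  space :> topologicalType;
  sheafO : ring_sheaf space;
  scheme_local : locally_ringed sheafO;
  scheme_affine : forall x : space,
    exists U : opens space, oset U x /\ affine_open sheafO U
}.
Notation "'`O_' X" := (sheafO X) (at level 8, X at level 2, format "'`O_' X").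

(* The comorphism of f is given as a compatible family of ring homomorphisms
   O_Y(U) -> O_X(V), indexed by the pairs of open sets with f(V) inside U; it
   amounts to the usual one O_Y -> f_* O_X, which is the case V = f^-1(U). *)
Record scheme_hom (X Y : scheme) := SchemeHom {
  smap :> X -> Y;
  smap_cont : continuous smap;
  sharp : forall (U : opens Y) (V : opens X), V `<=` smap @^-1` U ->
    {rmorphism `O_Y U -> `O_X V};
  sharp_res : forall (U U' : opens Y) (V V' : opens X) (UU : U' `<=` U)
    (VV : V' `<=` V) (VU : V `<=` smap @^-1` U) (VU' : V' `<=` smap @^-1` U')
    (s : `O_Y U), res VV (sharp VU s) = sharp VU' (res UU s);
  sharp_local : forall (U : opens Y) (V : opens X)
    (VU : V `<=` smap @^-1` U) (s : `O_Y U) (x : X), oset V x ->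
    germ_unit (sharp VU s) x -> germ_unit s (smap x)
}.
Arguments smap_cont {X Y} _.
Arguments sharp {X Y} _ {U V} _.

Lemma rmorphism_eq (A B : pzRingType) (f g : {rmorphism A -> B}) :
  (f : A -> B) = g -> f = g.
Proof.
case: f g => [f [[fa] [fm]]] [g [[ga] [gm]]] /= e.
case: _ / e in ga gm *.
by rewrite (Prop_irrelevance fa ga) (Prop_irrelevance fm gm).
Qed.

Section SchemeCategory.

Lemma scheme_hom_eq (X Y : scheme) (f g : scheme_hom X Y) :
  (f : X -> Y) = g ->
  (forall (U : opens Y) (V : opens X) (Vf : V `<=` f @^-1` U)
    (Vg : V `<=` g @^-1` U) (s : `O_Y U), sharp f Vf s = sharp g Vg s) ->
  f = g.
Proof.
case: f g => [f cf sf rf lf] [g cg sg rg lg] /= e.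
case: _ / e in cg sg rg lg * => /= e.
have e' : sf = sg.
  apply: functional_extensionality_dep => U.
  apply: functional_extensionality_dep => V.
  apply: functional_extensionality_dep => VU.
  by apply: rmorphism_eq; apply: funext => s; apply: e.
case: _ / e' in rg lg e *.
by rewrite (Prop_irrelevance cf cg) (Prop_irrelevance rf rg)
  (Prop_irrelevance lf lg).
Qed.

Lemma scheme_id_local (X : scheme) (U V : opens X) (VU : V `<=` U)
    (s : `O_X U) (x : X) : oset V x -> germ_unit (res VU s) x -> germ_unit s x.
Proof.
move=> Vx [W [WV [Wx [t st]]]]; exists W, (subset_trans WV VU); split=> //.
by exists t; rewrite -st (res_comp _ _ (subset_trans WV VU)).
Qed.

Lemma scheme_id_res (X : scheme) (U U' V V' : opens X) (UU : U' `<=` U)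
    (VV : V' `<=` V) (VU : V `<=` U) (VU' : V' `<=` U') (s : `O_X U) :
  res VV (res VU s) = res VU' (res UU s).
Proof. by rewrite !(res_comp _ _ (subset_trans VV VU)). Qed.

Definition scheme_id (X : scheme) : scheme_hom X X :=
  @SchemeHom X X (fun x => x) (fun x => cvg_id) (fun U V VU => res VU)
    (@scheme_id_res X) (@scheme_id_local X).

Variables X Y Z : scheme.
Variables (g : scheme_hom Y Z) (f : scheme_hom X Y).

Lemma scheme_comp_cont : continuous (fun x => g (f x)).
Proof.
by move=> x; apply: continuous_comp; [apply: smap_cont|apply: smap_cont].
Qed.

Definition sharp_comp (U : opens Z) (V : opens X)
    (VU : V `<=` (fun x => g (f x)) @^-1` U) : {rmorphism `O_Z U -> `O_X V} :=
  (@sharp _ _ f (preim (smap_cont g) U) V VU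
    \o @sharp _ _ g U (preim (smap_cont g) U) (@subset_refl _ _))%FUN.

Lemma scheme_comp_res (U U' : opens Z) (V V' : opens X) (UU : U' `<=` U)
    (VV : V' `<=` V) (VU : V `<=` (fun x => g (f x)) @^-1` U)
    (VU' : V' `<=` (fun x => g (f x)) @^-1` U') (s : `O_Z U) :
  res VV (sharp_comp VU s) = sharp_comp VU' (res UU s).
Proof.
rewrite /sharp_comp /=.
rewrite (sharp_res (preim_subset (cf := smap_cont g) UU) VV VU VU').
by congr (@sharp _ _ f (preim (smap_cont g) U') V' VU' _); apply: sharp_res.
Qed.

Lemma scheme_comp_local (U : opens Z) (V : opens X)
    (VU : V `<=` (fun x => g (f x)) @^-1` U) (s : `O_Z U) (x : X) :
  oset V x -> germ_unit (sharp_comp VU s) x -> germ_unit s (g (f x)).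
Proof. by move=> Vx /sharp_local => /(_ Vx)/sharp_local; apply; apply: VU. Qed.

Definition scheme_comp : scheme_hom X Z :=
  SchemeHom scheme_comp_cont scheme_comp_res scheme_comp_local.

End SchemeCategory.

Lemma scheme_comp1m (X Y : scheme) (f : scheme_hom X Y) :
  scheme_comp (scheme_id Y) f = f.
Proof.
apply: scheme_hom_eq => // U V Vf Vg s /=.
rewrite -[RHS](res_id (@subset_refl _ V)).
by rewrite (sharp_res (U' := preim (smap_cont (scheme_id Y)) U)
  (@subset_refl _ U) _ Vg Vf).
Qed.

Lemma scheme_compm1 (X Y : scheme) (f : scheme_hom X Y) :
  scheme_comp f (scheme_id X) = f.
Proof.
apply: scheme_hom_eq => // U V Vf Vg s /=.
by rewrite (sharp_res (@subset_refl _ U) _ _ Vg) res_id.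
Qed.

Lemma scheme_compA (X Y Z T : scheme) (h : scheme_hom Z T)
    (g : scheme_hom Y Z) (f : scheme_hom X Y) :
  scheme_comp h (scheme_comp g f) = scheme_comp (scheme_comp h g) f.
Proof.
apply: scheme_hom_eq => // U V Vf Vg s /=; rewrite /sharp_comp /=.
set hU := preim (smap_cont h) U.
set ghU := preim (smap_cont g) hU.
set ghU' := preim (smap_cont (scheme_comp h g)) U.
have sub : ghU `<=` ghU' by [].
rewrite -[RHS](res_id (@subset_refl _ V)).
rewrite (sharp_res (U' := ghU) sub (@subset_refl _ V) _ Vf).
congr (@sharp _ _ f ghU V Vf _).
rewrite (sharp_res (@subset_refl _ hU) sub _ (@subset_refl _ ghU)).
by rewrite (res_id (@subset_refl _ hU)).
Qed.

Definition Sch : category :=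
  Category scheme_comp1m scheme_compm1 scheme_compA.

Record derivation (W S : scheme) (w : scheme_hom W S)
    (M : module_sheaf `O_W) := Derivation {
  der :> forall U : opens W, `O_W U -> M U;
  derD : forall (U : opens W) (a b : `O_W U),
    der (a + b) = der a + der b;
  derM : forall (U : opens W) (a b : `O_W U),
    der (a * b) = a *: der b + b *: der a;
  der_res : forall (U V : opens W) (VU : V `<=` U) (a : `O_W U),
    mres VU (der a) = der (res VU a);
  der_base : forall (U : opens S) (V : opens W) (VU : V `<=` w @^-1` U)
    (s : `O_S U), der (sharp w VU s) = 0
}.

(* d : O_W -> Om is the universal S-derivation, i.e. Om = Omega^1_{W/S}. *)
Definition is_differentials (W S : scheme) (w : scheme_hom W S)
    (Om : module_sheaf `O_W) (d : derivation w Om) : Prop :=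
  forall (N : module_sheaf `O_W) (D : derivation w N),
    exists! u : module_sheaf_hom Om N,
      forall (U : opens W) (a : `O_W U), u U (d U a) = D U a.

Definition is_symmetric_algebra (X : topologicalType) (O : ring_sheaf X)
    (M : module_sheaf O) (A : algebra_sheaf O)
    (i : module_sheaf_hom M (algebra_module A)) : Prop :=
  forall (B : algebra_sheaf O) (j : module_sheaf_hom M (algebra_module B)),
    exists! u : algebra_sheaf_hom A B,
      forall (U : opens X) (m : M U), u U (i U m) = j U m.

Section DirectImageAlgebra.
Variables (T W : scheme) (p : scheme_hom T W).

Definition direct_image_struct :
    ring_sheaf_hom `O_W (direct_image (smap_cont p) `O_T) :=
  @RingSheafHom W `O_W (direct_image (smap_cont p) `O_T)
    (fun U => @sharp _ _ p U (preim (smap_cont p) U) (@subset_refl _ _))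
    (fun U V VU s => sharp_res VU _ _ _ s).

Definition direct_image_algebra : algebra_sheaf `O_W :=
  AlgebraSheaf direct_image_struct.

End DirectImageAlgebra.

(* p : T -> W is the relative spectrum of the O_W-algebra A: it is an affine
   morphism, and alpha is an isomorphism from A to p_* O_T. *)
Record is_relative_spec (T W : scheme) (p : scheme_hom T W)
    (A : algebra_sheaf `O_W)
    (alpha : algebra_sheaf_hom A (direct_image_algebra p)) : Prop :=
  IsRelativeSpec {
  rspec_affine : forall U : opens W, affine_open `O_W U ->
    affine_open `O_T (preim (smap_cont p) U);
  rspec_bij : forall U : opens W, bijective (alpha U)
}.

(* T_{W/S} = Spec_W (Sym Omega^1_{W/S}), with its projection to W. *)
Record tangent_scheme (W S : scheme) (w : scheme_hom W S) := TangentScheme {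
  tg_Omega : module_sheaf `O_W;
  tg_d : derivation w tg_Omega;
  tg_OmegaP : is_differentials tg_d;
  tg_Sym : algebra_sheaf `O_W;
  tg_in : module_sheaf_hom tg_Omega (algebra_module tg_Sym);
  tg_SymP : is_symmetric_algebra tg_in;
  tg_scheme : scheme;
  tg_proj : scheme_hom tg_scheme W;
  tg_alpha : algebra_sheaf_hom tg_Sym (direct_image_algebra tg_proj);
  tg_SpecP : is_relative_spec tg_alpha
}.
Arguments tg_scheme {W S w} _.
Arguments tg_proj {W S w} _.

(* The section db of O_{T_{W/S}} over the inverse image of U, for b a section
   of O_W over U. *)
Definition tg_diff (W S : scheme) (w : scheme_hom W S) (T : tangent_scheme w)
    (U : opens W) (b : `O_W U) :
    `O_(tg_scheme T) (preim (smap_cont (tg_proj T)) U) :=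
  tg_alpha T U (tg_in T U (tg_d T U b)).

(* The tangent functor of Sch/S.  For h : W -> W' over S, the morphism T_{h/S}
   is the one above h sending db to d(h^# b). *)
Record tangent_functor (S : Sch) := TangentFunctor {
  tgf_scheme : forall W : slice S, tangent_scheme (sstr W);
  tgf_ob : slice S -> slice S := fun W =>
    @SliceOb Sch S (tg_scheme (tgf_scheme W))
      (sstr W \o_c (tg_proj (tgf_scheme W) : @hom Sch _ _));
  tgf_map : forall W W' : slice S, hom W W' -> hom (tgf_ob W) (tgf_ob W');
  tgf_id : forall W : slice S, tgf_map (idm W) = idm (tgf_ob W);
  tgf_comp : forall (W1 W2 W3 : slice S) (h : hom W2 W3) (g : hom W1 W2),
    tgf_map (h \o_c g) = tgf_map h \o_c tgf_map g;
  tgf_mapE : forall (W W' : slice S) (h : hom W W'),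
    (tg_proj (tgf_scheme W') : @hom Sch _ _) \o_c smor (tgf_map h)
    = smor h \o_c tg_proj (tgf_scheme W);
  tgf_mapd : forall (W W' : slice S) (h : hom W W')
    (V : opens (sdom W' : scheme)) (U : opens (sdom W : scheme))
    (UV : U `<=` (smor h : scheme_hom _ _) @^-1` V)
    (TUV : preim (smap_cont (tg_proj (tgf_scheme W))) U `<=`
       (smor (tgf_map h) : scheme_hom _ _)
         @^-1` preim (smap_cont (tg_proj (tgf_scheme W'))) V)
    (b : `O_(sdom W' : scheme) V),
    sharp (smor (tgf_map h)) TUV (tg_diff (tgf_scheme W') b)
    = tg_diff (tgf_scheme W) (sharp (smor h) UV b)
}.

Section TangentFunctor.
Variables (S : Sch) (T : tangent_functor S).

Definition tangent_data : functor_data (slice S) (slice S) :=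
  @FunctorData (slice S) (slice S) (tgf_ob T) (@tgf_map S T).

Definition tangent : functor (slice S) (slice S) :=
  @Functor (slice S) (slice S) tangent_data (@tgf_id S T) (@tgf_comp S T).

Definition tangent_proj (W : slice S) : hom (tangent W) W :=
  @SliceHom Sch S (tangent W) W (tg_proj (tgf_scheme T W)) erefl.

End TangentFunctor.

(* theta : T_{W/Y} x_Y X -> T_{W x_Y X/X} is the canonical morphism.  For an
   affine W x_Y X = Spec (B ox_C A), write b ox a for the product of the
   pullbacks of b and a.  The first condition says that theta lies above
   W x_Y X, i.e. theta^# (b ox a) = b ox a, and the second one that
   theta^# (d (b ox a)) = db ox a. *)
Record is_tangent_base_change (PB : pullbacks Sch)
    (T : forall S : Sch, tangent_functor S) (X Y : Sch) (f : hom X Y)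
    (W : slice Y)
    (theta : hom (base_change PB f (tangent (T Y) W))
                 (tangent (T X) (base_change PB f W))) : Prop :=
  IsTangentBaseChange {
  tbc_proj : tangent_proj (T X) (base_change PB f W) \o_c theta
    = fmap (base_change PB f) (tangent_proj (T Y) W);
  tbc_diff :
    let TW := tgf_scheme (T Y) W in
    let TWX := tgf_scheme (T X) (base_change PB f W) in
    let pW : scheme_hom _ _ := pb1 PB (sstr W) f in
    let pX : scheme_hom _ _ := pb2 PB (sstr W) f in
    let qT : scheme_hom _ _ := pb1 PB (sstr (tangent (T Y) W)) f in
    let qX : scheme_hom _ _ := pb2 PB (sstr (tangent (T Y) W)) f in
    let th : scheme_hom _ _ := smor theta in
    forall (V : opens (sdom W : scheme)) (V' : opens (X : scheme))
      (U : opens (pb PB (sstr W) f : scheme))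
      (U' : opens (pb PB (sstr (tangent (T Y) W)) f : scheme))
      (UV : U `<=` pW @^-1` V) (UV' : U `<=` pX @^-1` V')
      (U'U : U' `<=` th @^-1` preim (smap_cont (tg_proj TWX)) U)
      (U'V : U' `<=` qT @^-1` preim (smap_cont (tg_proj TW)) V)
      (U'V' : U' `<=` qX @^-1` V')
      (b : `O_(sdom W : scheme) V) (a : `O_(X : scheme) V'),
    sharp th U'U (tg_diff TWX (sharp pW UV b * sharp pX UV' a))
    = sharp qT U'V (tg_diff TW b) * sharp qX U'V' a
}.

(* Main.v *)
From HB Require Import structures.
From mathcomp Require Import all_boot all_order all_algebra.
From mathcomp Require Import all_classical topology.
From mathcomp Require Import ring.
Require Import Defs.

(* Both composites, read in the direction of the [fT], are morphisms over [X]
   from [f^* g^* T_{W/Z}] to [T_{(g f)^* W/X}] with the same projection to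
   [P = (g f)^* W = W x_Z X], and both pull [d (p^# b)] back to the same
   function, for [b] a function on [W] and [p : P -> W] the projection.  So the
   point is that a morphism [V -> T_{P/X}] is determined by these data.  It
   corresponds to a derivation of [O_P] over [X] with values in the direct
   image of [O_V], and such a derivation [D] is the same as a morphism
   [V[eps] -> P], [s |-> s + eps D s], out of the scheme of dual numbers of
   [V]; the universal property of [P], applied to [V[eps]], then says that [D]
   is determined by its values on the functions coming from [W].  No explicit
   description of fibre products of schemes is needed. *)

Set Implicit Arguments.
Unset Strict Implicit.
Unset Printing Implicit Defensive.
Import GRing.Theory.
Local Open Scope classical_set_scope.
Local Open Scope ring_scope.

(* [(a, b)] stands for [a + b * eps] with [eps ^+ 2 = 0]. *)
Definition dual (R : comPzRingType) : Type := (R * R)%type.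

Section DualNumbers.
Variable R : comPzRingType.

HB.instance Definition _ := GRing.Zmodule.on (dual R).

Definition dual_mul (x y : dual R) : dual R :=
  (x.1 * y.1, x.1 * y.2 + x.2 * y.1).

Fact dual_mulA : associative dual_mul.
Proof. by move=> x y z; congr pair => /=; ring. Qed.

Fact dual_mulC : commutative dual_mul.
Proof. by move=> x y; congr pair => /=; ring. Qed.

Fact dual_mul1 : left_id ((1, 0) : dual R) dual_mul.
Proof. by move=> [a b]; congr pair => /=; ring. Qed.

Fact dual_mulD : left_distributive dual_mul +%R.
Proof. by move=> x y z; congr pair => /=; ring. Qed.

HB.instance Definition _ := GRing.Zmodule_isComPzRing.Build (dual R)
  dual_mulA dual_mulC dual_mul1 dual_mulD.

Definition dual_cst (a : R) : dual R := (a, 0).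
Definition dual_eps : dual R := (0, 1).

Lemma dual_eps2 : dual_eps * dual_eps = 0.
Proof. by congr pair => /=; ring. Qed.

Lemma dual_decomp (x : dual R) : x = dual_cst x.1 + dual_cst x.2 * dual_eps.
Proof. by case: x => a b; congr pair => /=; ring. Qed.

Lemma dual_exp (x : dual R) n :
  x ^+ n.+1 = (x.1 ^+ n.+1, x.1 ^+ n * x.2 *+ n.+1).
Proof.
elim: n => [|n IHn]; first by case: x => a b; rewrite expr1 expr0 mul1r.
rewrite exprS IHn; congr pair => /=.
by rewrite [RHS]mulrSr mulrnAr mulrA -exprS [x.2 * _]mulrC.
Qed.

Lemma dual_unit (x : dual R) :
  (exists y, x * y = 1) <-> exists b, x.1 * b = 1.
Proof.
split=> [[y xy]|[b xb]]; first by exists y.1; have := congr1 fst xy.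
exists ((b, - x.2 * b ^+ 2) : dual R); congr pair => //=.
by rewrite mulNr mulrN -[x.2 * b]mulr1 -xb; ring.
Qed.

End DualNumbers.

Section DualMap.
Variables (A B : comPzRingType) (f : {rmorphism A -> B}).

Definition dual_map (x : dual A) : dual B := (f x.1, f x.2).

Fact dual_map_zmod_morphism : zmod_morphism dual_map.
Proof. by move=> x y; congr pair => /=; rewrite rmorphB. Qed.

Fact dual_map_monoid_morphism : monoid_morphism dual_map.
Proof.
split=> [|x y]; first by congr pair => /=; rewrite (rmorph0, rmorph1).
by congr pair => /=; rewrite ?rmorphD !rmorphM.
Qed.

HB.instance Definition _ :=
  GRing.isZmodMorphism.Build (dual A) (dual B) dual_map dual_map_zmod_morphism.
HB.instance Definition _ :=
  GRing.isMonoidMorphism.Build (dual A) (dual B) dual_map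
    dual_map_monoid_morphism.

Lemma dual_localization (a : dual A) :
  is_localization f a.1 -> is_localization dual_map a.
Proof.
move=> [fu ff fk]; split.
- exact/dual_unit.
- move=> [b1 b2]; have [n1 [r1 br1]] := ff b1; have [n2 [r2 br2]] := ff b2.
  exists (n1 + n2).+1.
  exists ((r1 * a.1 ^+ n2.+1, r2 * a.1 ^+ n1.+1
    + r1 * a.1 ^+ n2 * a.2 *+ (n1 + n2).+1) : dual A).
  rewrite dual_exp; congr pair => /=.
    by rewrite rmorphM rmorphXn -br1 -addnS exprD mulrA.
  rewrite rmorphD rmorphMn /= !rmorphM !rmorphXn -br1 -br2 -mulrnAr.
  rewrite addrC; congr (_ + _).
    by rewrite addnC -addnS exprD mulrA.
  by rewrite !mulrnAr exprD !mulrA.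
- move=> [r1 r2] [/fk[n1 r1E] /fk[n2 r2E]].
  have r1E' : a.1 ^+ (n1 + n2) * r1 = 0.
    by rewrite addnC exprD -mulrA r1E mulr0.
  exists (n1 + n2).+1; rewrite dual_exp; congr pair => /=.
    by rewrite exprS -mulrA r1E' mulr0.
  rewrite mulrnAl mulrAC r1E' mul0r mul0rn addr0.
  by rewrite -addSn exprD -mulrA r2E mulr0.
Qed.

End DualMap.

Section DualSheaf.
Variables (X : topologicalType) (F : ring_sheaf X).

Definition dual_res (U V : opens X) (VU : V `<=` U) :
  {rmorphism dual (F U) -> dual (F V)} := dual_map (res VU).

Fact dual_res_id (U : opens X) (UU : U `<=` U) (s : dual (F U)) :
  dual_res UU s = s.
Proof. by case: s => a b; congr pair => /=; apply: res_id. Qed.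

Fact dual_res_comp (U V W : opens X) (VU : V `<=` U) (WV : W `<=` V)
    (WU : W `<=` U) (s : dual (F U)) :
  dual_res WV (dual_res VU s) = dual_res WU s.
Proof. by congr pair => /=; apply: res_comp. Qed.

Fact dual_sheafP :
  is_sheaf (fun U V VU => dual_res VU : dual (F U) -> dual (F V)).
Proof.
move=> I U V VU UV s ss.
have [i j W Wi Wj|t1 [t1E t1u]] := ring_sheafP VU UV (s := fun i => (s i).1).
  by case: (ss i j W Wi Wj).
have [i j W Wi Wj|t2 [t2E t2u]] := ring_sheafP VU UV (s := fun i => (s i).2).
  by case: (ss i j W Wi Wj).
exists (t1, t2); split=> [i|[u1 u2] uE].
  by rewrite [RHS]surjective_pairing; congr pair => /=.
by congr pair; [apply: t1u|apply: t2u] => i; rewrite -uE.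
Qed.

Definition dual_sheaf : ring_sheaf X :=
  @RingSheaf X (fun U => dual (F U)) dual_res dual_res_id dual_res_comp
    dual_sheafP.

Lemma dual_germ_unit (U : opens X) (s : dual_sheaf U) (x : X) :
  germ_unit s x <-> germ_unit (s.1 : F U) x.
Proof.
split=> -[V [VU [Vx u]]]; exists V, VU; split => //.
  by apply/(dual_unit (res VU s : dual (F V))).
by apply/(dual_unit (res VU s : dual (F V))).
Qed.

Lemma dual_locally_ringed : locally_ringed F -> locally_ringed dual_sheaf.
Proof.
move=> [F0 Floc]; split=> [x U Ux /(congr1 fst) e|x U s t Ux].
  exact: (F0 x U Ux e).
by rewrite !dual_germ_unit => /Floc; apply.
Qed.

Lemma dual_is_spec (U : opens X) (A : comPzRingType)
    (h : {rmorphism A -> F U}) :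
  is_spec h ->
  is_spec (F := dual_sheaf) (dual_map h : {rmorphism dual A -> dual (F U)}).
Proof.
move=> [hprime hinj hsurj hbasis hsec]; split.
- move=> x Ux; have [P0 PD PM P1 PP] := hprime x Ux.
  split=> [|a b|a b||a b] /=; rewrite !dual_germ_unit //=.
  + exact: PD.
  + exact: PM.
  + exact: PP.
- move=> x y Ux Uy xy; apply: hinj => // a.
  by have := xy (dual_cst a); rewrite !dual_germ_unit.
- move=> P [P0 PD PM P1 PP].
  have Peps : P (dual_eps A).
    by have: P (dual_eps A * dual_eps A); [rewrite dual_eps2|case/PP].
  have Pcst (a : dual A) : P a <-> P (dual_cst a.1).
    split=> [Pa|Pa1]; last first.
      by rewrite (dual_decomp a); apply: PD => //; apply: PM.
    have -> : dual_cst a.1 = a + dual_cst (- a.2) * dual_eps A.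
      by congr pair => /=; ring.
    by apply: PD => //; apply: PM.
  have [|x [Ux PE]] := hsurj [set a | P (dual_cst a)].
    split=> //= a b.
    + by move=> Pa Pb; have := PD _ _ Pa Pb; rewrite Pcst.
    + by move=> /(PM (dual_cst a)); rewrite Pcst.
    + by move=> Pab; apply: PP; rewrite Pcst.
  have {}PE a : P (dual_cst a) <-> ~ germ_unit (h a) x.
    by rewrite -[P _]/([set a | P (dual_cst a)] a) PE.
  exists x; split=> //; apply/seteqP; split=> a /=.
    by rewrite dual_germ_unit Pcst PE.
  by rewrite dual_germ_unit Pcst PE.
- move=> V VU x Vx; have [a [ax aV]] := hbasis V VU x Vx.
  exists (dual_cst a); split=> [|y Uy]; rewrite dual_germ_unit //.
  exact: aV.
- move=> a V VU VE.
  apply: (@dual_localization _ _ (res VU \o h)%FUN).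
  by apply: hsec => x /VE; rewrite dual_germ_unit.
Qed.

End DualSheaf.

(* [V[eps]]: the space of [V] with the sheaf [O_V + eps O_V]. *)
Definition dual_scheme (V : scheme) : scheme.
Proof.
apply: (@Scheme V (dual_sheaf `O_V)).
  exact: dual_locally_ringed (scheme_local V).
move=> x; have [U [Ux [A [h hP]]]] := scheme_affine x.
by exists U; split=> //; exists (dual A), (dual_map h); apply: dual_is_spec.
Defined.

Lemma sharp_scheme_comp (X Y Z : scheme) (g : scheme_hom Y Z)
    (f : scheme_hom X Y) (U : opens Z) (U' : opens Y) (V : opens X)
    (gU : U' `<=` g @^-1` U) (fV : V `<=` f @^-1` U')
    (VU : V `<=` scheme_comp g f @^-1` U) (s : `O_Z U) :
  sharp (scheme_comp g f) VU s = sharp f fV (sharp g gU s).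
Proof.
rewrite /= /sharp_comp /= -[LHS](res_id (@subset_refl _ V)).
have sub : U' `<=` preim (smap_cont g) U by [].
rewrite (sharp_res sub (@subset_refl _ V) _ fV).
congr (@sharp _ _ f U' V fV _).
by rewrite (sharp_res (@subset_refl _ U) sub _ gU) res_id.
Qed.

Lemma eq_sharp (X Y : scheme) (f g : scheme_hom X Y) (U : opens Y)
    (V : opens X) (Vf : V `<=` f @^-1` U) (Vg : V `<=` g @^-1` U)
    (s : `O_Y U) :
  f = g -> sharp f Vf s = sharp g Vg s.
Proof.
by move=> e; case: _ / e in Vg *; rewrite (Prop_irrelevance Vf Vg).
Qed.

Section DualHom.
Variables (P S V : scheme) (w : scheme_hom P S) (p : scheme_hom V P).
Variable D : derivation w (algebra_module (direct_image_algebra p)).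

Lemma direct_derD (U : opens P) (a b : `O_P U) :
  D U (a + b) = D U a + D U b :> `O_V (preim (smap_cont p) U).
Proof. exact: (derD D a b). Qed.

Lemma direct_derM (U : opens P) (a b : `O_P U) :
  D U (a * b) = sharp p (@subset_refl _ (preim (smap_cont p) U)) a * D U b
    + sharp p (@subset_refl _ (preim (smap_cont p) U)) b * D U a
    :> `O_V (preim (smap_cont p) U).
Proof. have e := derM D a b; exact: e. Qed.

Lemma direct_derB (U : opens P) (a b : `O_P U) :
  D U (a - b) = D U a - D U b :> `O_V (preim (smap_cont p) U).
Proof.
by apply/eqP; rewrite eq_sym subr_eq; apply/eqP; rewrite -direct_derD subrK.
Qed.

Lemma direct_der1 (U : opens P) :
  D U 1 = 0 :> `O_V (preim (smap_cont p) U).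
Proof.
have := direct_derM (1 : `O_P U) 1; rewrite mulr1 rmorph1 mul1r => /eqP.
by rewrite -subr_eq subrr => /eqP.
Qed.

Section Sharp.
Variables (U : opens P) (V' : opens V) (VU : V' `<=` p @^-1` U).

Definition dual_sharp (s : `O_P U) : dual (`O_V V') :=
  (sharp p VU s, res (VU : V' `<=` preim (smap_cont p) U) (D U s)).

Fact dual_sharp_zmod_morphism : zmod_morphism dual_sharp.
Proof.
move=> a b; congr pair; rewrite /= ?rmorphB //.
by rewrite -rmorphB direct_derB.
Qed.

Fact dual_sharp_monoid_morphism : monoid_morphism dual_sharp.
Proof.
split=> [|a b]; first by congr pair; rewrite ?rmorph1 // direct_der1 rmorph0.
congr pair; rewrite /= ?rmorphM // direct_derM rmorphD !rmorphM.
rewrite !(sharp_res (@subset_refl _ U) _ _ VU) !res_id.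
by congr (_ + _); rewrite mulrC.
Qed.

HB.instance Definition _ := GRing.isZmodMorphism.Build (`O_P U)
  (dual (`O_V V')) dual_sharp dual_sharp_zmod_morphism.
HB.instance Definition _ := GRing.isMonoidMorphism.Build (`O_P U)
  (dual (`O_V V')) dual_sharp dual_sharp_monoid_morphism.

End Sharp.

Fact dual_hom_res (U U' : opens P) (V1 V2 : opens V) (UU : U' `<=` U)
    (VV : V2 `<=` V1) (VU : V1 `<=` p @^-1` U) (VU' : V2 `<=` p @^-1` U')
    (s : `O_P U) :
  dual_res `O_V VV (dual_sharp VU s) = dual_sharp VU' (res UU s).
Proof.
congr pair => /=; first exact: sharp_res.
have sub : V2 `<=` preim (smap_cont p) U := subset_trans VV VU.
by rewrite -der_res /= !(res_comp _ _ sub).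
Qed.

Fact dual_hom_local (U : opens P) (V' : opens V) (VU : V' `<=` p @^-1` U)
    (s : `O_P U) (x : V) : oset V' x ->
  germ_unit (dual_sharp VU s : dual_sheaf `O_V V') x -> germ_unit s (p x).
Proof. by move=> Vx /dual_germ_unit; apply: sharp_local. Qed.

(* On functions: [s |-> p^# s + eps * D s]. *)
Definition dual_hom : scheme_hom (dual_scheme V) P :=
  @SchemeHom (dual_scheme V) P p (smap_cont p)
    (fun U V' VU => dual_sharp VU : {rmorphism _ -> _})
    dual_hom_res dual_hom_local.

End DualHom.

(* Two derivations that agree on the functions pulled back from [W] define
   morphisms [V[eps] -> W x_S X] with the same projections. *)
Lemma pullback_derivation_eq (PB : pullbacks Sch) (W X S : Sch)
    (w : hom W S) (f : hom X S) (V : scheme)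
    (p : scheme_hom V (pb PB w f : scheme))
    (D1 D2 : derivation (pb2 PB w f : scheme_hom _ _)
      (algebra_module (direct_image_algebra p))) :
  (forall (U : opens (W : scheme)) (U' : opens (pb PB w f : scheme))
     (UU : U' `<=` (pb1 PB w f : scheme_hom _ _) @^-1` U)
     (b : `O_(W : scheme) U),
     D1 U' (sharp (pb1 PB w f : scheme_hom _ _) UU b)
     = D2 U' (sharp (pb1 PB w f : scheme_hom _ _) UU b)) ->
  forall U s, D1 U s = D2 U s.
Proof.
move=> D12 U s.
have e : dual_hom D1 = dual_hom D2.
  apply: (@pb_uniq _ PB _ _ _ w f (dual_scheme V)).
    apply: (@scheme_hom_eq (dual_scheme V) W) => // U1 V1 Vf Vg t.
    rewrite -(Prop_irrelevance Vf Vg); congr pair => /=.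
    by rewrite D12.
  apply: (@scheme_hom_eq (dual_scheme V) X) => // U1 V1 Vf Vg t.
  rewrite -(Prop_irrelevance Vf Vg); congr pair => /=.
  by rewrite !der_base.
have UU : preim (smap_cont p) U `<=` p @^-1` U by [].
have :=
  @eq_sharp (dual_scheme V) _ (dual_hom D1) (dual_hom D2) U
    (preim (smap_cont p) U) UU UU s e.
by move=> /(congr1 snd) /=; rewrite !res_id.
Qed.

Lemma sheaf_eq (X : topologicalType) (F : ring_sheaf X) (U : opens X)
    (s t : F U) :
  (forall x, oset U x ->
    exists (V : opens X) (VU : V `<=` U), oset V x /\ res VU s = res VU t) ->
  s = t.
Proof.
move=> st.
pose I := {V : opens X & {VU : V `<=` U | res VU s = res VU t}}.
pose V (i : I) := projT1 i.
pose sub (i : I) : V i `<=` U := sval (projT2 i).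
have UV : U `<=` \bigcup_i V i.
  move=> x /st[V' [VU' [Vx e]]].
  by exists (existT _ V' (exist _ VU' e)).
have [i j W Wi Wj|z [_ zu]] := ring_sheafP sub UV (s := fun i => res (sub i) s).
  by rewrite !(res_comp _ _ (subset_trans Wi (sub i))).
rewrite -(zu s) //; apply: zu => i; rewrite -(svalP (projT2 i)) //.
Qed.

Lemma open_germ_unit (X : topologicalType) (F : ring_sheaf X) (U : opens X)
    (s : F U) : open [set x | oset U x /\ germ_unit s x].
Proof.
rewrite openE => x [Ux [V [VU [Vx st]]]].
apply: filterS (open_nbhs_nbhs (conj (osetP V) Vx)) => y Vy.
by split; [exact: (VU y)|exists V, VU].
Qed.

Lemma germ_unit_sharp (X Y : scheme) (f : scheme_hom X Y) (U : opens Y)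
    (U' : opens X) (UU : U' `<=` f @^-1` U) (s : `O_Y U) (x : X) :
  oset U' x -> germ_unit (sharp f UU s) x <-> germ_unit s (f x).
Proof.
move=> Ux; split=> [|[U1 [U1U [Ufx [t st]]]]]; first exact: sharp_local.
pose U2 := Opens (openI (osetP U') (osetP (preim (smap_cont f) U1))).
have sub : U2 `<=` U' by move=> y [].
have sub' : U2 `<=` f @^-1` U1 by move=> y [].
exists U2, sub; split=> //; exists (sharp f sub' t).
by rewrite (sharp_res U1U _ _ sub') -rmorphM st rmorph1.
Qed.

Section ModuleHomComp.
Variables (X : topologicalType) (O : ring_sheaf X) (M : module_sheaf O).
Variables (A B : algebra_sheaf O) (u : algebra_sheaf_hom A B).
Variable i : module_sheaf_hom M (algebra_module A).

Definition alg_comp (U : opens X) (m : M U) : algebra_module B U :=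
  u U (i U m).

Fact alg_comp_linear (U : opens X) : linear (@alg_comp U).
Proof.
move=> a m n; rewrite /alg_comp linearP.
rewrite [LHS](rmorphD (u U)) [X in X + _](rmorphM (u U)).
by rewrite ash_struct.
Qed.

HB.instance Definition _ (U : opens X) :=
  GRing.isLinear.Build (O U) (M U) (algebra_module B U) *:%R (@alg_comp U)
    (@alg_comp_linear U).

Fact alg_comp_res (U V : opens X) (VU : V `<=` U) (m : M U) :
  mres VU (alg_comp m) = alg_comp (mres VU m).
Proof. by rewrite /alg_comp -msh_res; apply: rsh_res. Qed.

Definition alg_module_comp : module_sheaf_hom M (algebra_module B) :=
  @ModuleSheafHom _ _ _ (algebra_module B)
    (fun U => @alg_comp U : {linear _ -> _}) alg_comp_res.

End ModuleHomComp.

Section DerivationComp.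
Variables (W S : scheme) (w : scheme_hom W S) (M N : module_sheaf `O_W).
Variables (v : module_sheaf_hom M N) (d : derivation w M).

Definition derivation_comp : derivation w N.
Proof.
apply: (@Derivation _ _ w N (fun U s => v U (d U s))).
- by move=> U a b; rewrite derD linearD.
- by move=> U a b; rewrite derM linearD !linearZ.
- by move=> U U' UU a; rewrite msh_res der_res.
- by move=> U U' UU s; rewrite der_base linear0.
Defined.

End DerivationComp.

Section TangentHom.
Variables (W S : scheme) (w : scheme_hom W S) (T : tangent_scheme w).
Variables (V : scheme) (p : scheme_hom V W).

Section AlgebraHom.
Variables (u : scheme_hom V (tg_scheme T)).
Hypothesis up : scheme_comp (tg_proj T) u = p.

Fact tangent_preim (U : opens W) :
  preim (smap_cont p) U `<=` u @^-1` preim (smap_cont (tg_proj T)) U.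
Proof. by move=> x; rewrite -up. Qed.

Definition tangent_ring_hom : ring_sheaf_hom (tg_Sym T)
  (direct_image (smap_cont p) `O_V).
Proof.
apply: (@RingSheafHom _ (tg_Sym T) (direct_image (smap_cont p) `O_V)
  (fun U => sharp u (@tangent_preim U) \o tg_alpha T U)%FUN).
move=> U U' UU s /=.
by rewrite -rsh_res; apply: sharp_res.
Defined.

Definition tangent_alg_hom :
  algebra_sheaf_hom (tg_Sym T) (direct_image_algebra p).
Proof.
apply: (@AlgebraSheafHom _ _ (tg_Sym T) (direct_image_algebra p)
  tangent_ring_hom) => U a /=.
transitivity (sharp u (@tangent_preim U)
    (alg_struct (direct_image_algebra (tg_proj T)) U a)).
  exact: (congr1 (sharp u (@tangent_preim U)) (ash_struct (tg_alpha T) a)).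
have VU : preim (smap_cont p) U `<=` scheme_comp (tg_proj T) u @^-1` U.
  by rewrite up.
rewrite /= -(sharp_scheme_comp _ _ VU).
exact: eq_sharp.
Defined.

(* [s |-> u^# (d s)] *)
Definition tangent_der :
    derivation w (algebra_module (direct_image_algebra p)) :=
  derivation_comp (alg_module_comp tangent_alg_hom (tg_in T)) (tg_d T).

End AlgebraHom.

Section Uniqueness.
Variables (u v : scheme_hom V (tg_scheme T)).
Hypotheses (up : scheme_comp (tg_proj T) u = p).
Hypotheses (vp : scheme_comp (tg_proj T) v = p).
Hypothesis uv : forall U s, tangent_der up U s = tangent_der vp U s.

Lemma tangent_hom_alg_eq (U : opens W)
    (s : `O_(tg_scheme T) (preim (smap_cont (tg_proj T)) U)) :
  sharp u (tangent_preim up (U := U)) s = sharp v (tangent_preim vp (U := U)) s.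
Proof.
have [j [_ jU]] := tg_OmegaP T (tangent_der up).
have eo : alg_module_comp (tangent_alg_hom up) (tg_in T)
  = alg_module_comp (tangent_alg_hom vp) (tg_in T).
  rewrite -(jU (alg_module_comp (tangent_alg_hom up) (tg_in T))) //.
  by apply: jU => U' a; rewrite uv.
have [k [_ kU]] := tg_SymP (alg_module_comp (tangent_alg_hom up) (tg_in T)).
have ea : tangent_alg_hom up = tangent_alg_hom vp.
  rewrite -(kU (tangent_alg_hom up)) //; apply: kU => U' m.
  by rewrite eo.
have [k' _ k'K] := rspec_bij (tg_SpecP T) U.
rewrite -[s]k'K.
have := congr1 (fun h : algebra_sheaf_hom _ _ => h U (k' s)) ea.
by [].
Qed.

Let pu (x : V) : tg_proj T (u x) = p x.
Proof. by rewrite -up. Qed.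

Let pv (x : V) : tg_proj T (v x) = p x.
Proof. by rewrite -vp. Qed.

Lemma tangent_hom_map_eq (x : V) : u x = v x.
Proof.
have [U [Ux Uaff]] := scheme_affine (p x).
have [A [h hP]] := rspec_affine (tg_SpecP T) Uaff.
apply: (spec_inj hP) => [||a].
- by rewrite /= /preimage /= pu.
- by rewrite /= /preimage /= pv.
have px : oset (preim (smap_cont p) U) x by [].
rewrite -(germ_unit_sharp (tangent_preim up (U := U)) (h a) px).
by rewrite -(germ_unit_sharp (tangent_preim vp (U := U)) (h a) px)
  tangent_hom_alg_eq.
Qed.

Lemma tangent_hom_eq_affine (U : opens W)
    (O : opens (tg_scheme T)) (V1 : opens V)
    (V1p : V1 `<=` preim (smap_cont p) U)
    (OU : O `<=` preim (smap_cont (tg_proj T)) U)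
    (uO : V1 `<=` u @^-1` O) (vO : V1 `<=` v @^-1` O)
    (s : `O_(tg_scheme T) (preim (smap_cont (tg_proj T)) U)) :
  sharp u uO (res OU s) = sharp v vO (res OU s).
Proof.
rewrite -(sharp_res OU V1p (tangent_preim up (U := U)) uO).
by rewrite -(sharp_res OU V1p (tangent_preim vp (U := U)) vO)
  tangent_hom_alg_eq.
Qed.

Lemma tangent_hom_eq : u = v.
Proof.
apply: scheme_hom_eq => [|O V0 V0u V0v s].
  by apply: funext => x; apply: tangent_hom_map_eq.
apply: sheaf_eq => x V0x.
have [U [Ux Uaff]] := scheme_affine (p x).
have [A [h hP]] := rspec_affine (tg_SpecP T) Uaff.
pose TU := preim (smap_cont (tg_proj T)) U.
pose O' := Opens (openI (osetP O) (osetP TU)).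
have O'TU : O' `<=` TU by move=> y [].
have O'x : oset O' (u x).
  by split; [exact: V0u|rewrite /= /preimage /= pu].
have [a [ax aO']] := spec_basis hP O'TU O'x.
pose Da := Opens (open_germ_unit (h a)).
have DaTU : Da `<=` TU by move=> y [].
have DaO : Da `<=` O by move=> y [TUy ay]; have [] := aO' y TUy ay.
have [|[b ab] hfrac _] := spec_sections hP (a := a) DaTU.
  by move=> y TUy; split=> [[]|].
have [n [r sr]] := hfrac (res DaO s).
pose V1 := Opens (openI (osetP V0) (osetP (preim (smap_cont u) Da))).
have V1V0 : V1 `<=` V0 by move=> y [].
have V1u : V1 `<=` u @^-1` Da by move=> y [].
have V1v : V1 `<=` v @^-1` Da.
  by move=> y /V1u; rewrite /preimage /= tangent_hom_map_eq.
have V1p : V1 `<=` preim (smap_cont p) U.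
  by move=> y /V1u [+ _]; rewrite /= /preimage /= pu.
exists V1, V1V0; split.
  by split => //; split => //; apply: O'TU.
rewrite (sharp_res DaO _ _ V1u) (sharp_res DaO _ _ V1v).
have /(congr1 (sharp u V1u)) := sr.
have /(congr1 (sharp v V1v)) := sr.
rewrite !rmorphM !rmorphXn (tangent_hom_eq_affine V1p DaTU V1u V1v (h r)) => <-.
rewrite (tangent_hom_eq_affine V1p DaTU V1u V1v (h a)) => e.
have abn : sharp v V1v (res DaTU (h a)) ^+ n * sharp v V1v b ^+ n = 1.
  by rewrite -exprMn -rmorphM ab rmorph1 expr1n.
by rewrite -[LHS]mulr1 -abn mulrA e -mulrA abn mulr1.
Qed.

End Uniqueness.
End TangentHom.

Lemma tg_diff_res (W S : scheme) (w : scheme_hom W S) (T : tangent_scheme w)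
    (U V : opens W) (VU : V `<=` U) (b : `O_W U) :
  res (preim_subset (cf := smap_cont (tg_proj T)) VU) (tg_diff T b)
  = tg_diff T (res VU b).
Proof.
rewrite /tg_diff -der_res -msh_res.
exact: (rsh_res (tg_alpha T) VU).
Qed.

Lemma tangent_hom_pullback_eq (PB : pullbacks Sch) (W X S : Sch)
    (w : hom W S) (f : hom X S)
    (T : tangent_scheme (pb2 PB w f : scheme_hom _ _)) (V : scheme)
    (u v : scheme_hom V (tg_scheme T)) :
  scheme_comp (tg_proj T) u = scheme_comp (tg_proj T) v ->
  (forall (U : opens (W : scheme)) (U' : opens (pb PB w f : scheme))
     (O : opens V) (UU : U' `<=` (pb1 PB w f : scheme_hom _ _) @^-1` U)
     (uO : O `<=` u @^-1` preim (smap_cont (tg_proj T)) U')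
     (vO : O `<=` v @^-1` preim (smap_cont (tg_proj T)) U')
     (b : `O_(W : scheme) U),
   sharp u uO (tg_diff T (sharp (pb1 PB w f : scheme_hom _ _) UU b))
   = sharp v vO (tg_diff T (sharp (pb1 PB w f : scheme_hom _ _) UU b))) ->
  u = v.
Proof.
move=> uv e; apply: (@tangent_hom_eq _ _ _ T V _ u v uv erefl).
by apply: pullback_derivation_eq => U U' UU b; apply: e.
Qed.

Lemma tgf_map_proj (S : Sch) (T : tangent_functor S) (W W' : slice S)
    (h : hom W W') (x : tg_scheme (tgf_scheme T W)) :
  tg_proj (tgf_scheme T W') ((smor (tgf_map T h) : scheme_hom _ _) x)
  = (smor h : scheme_hom _ _) (tg_proj (tgf_scheme T W) x).
Proof.
exact: (congr1 (fun g : scheme_hom _ _ => g x) (@tgf_mapE S T W W' h)).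
Qed.

Lemma tgf_map_diff (S : Sch) (T : tangent_functor S) (W W' : slice S)
    (h : hom W W') (N : scheme)
    (k : scheme_hom N (tg_scheme (tgf_scheme T W)))
    (V : opens (sdom W' : scheme)) (U : opens (sdom W : scheme)) (O : opens N)
    (UV : U `<=` (smor h : scheme_hom _ _) @^-1` V)
    (OU : O `<=` k @^-1` preim (smap_cont (tg_proj (tgf_scheme T W))) U)
    (OV : O `<=` scheme_comp (smor (tgf_map T h)) k
      @^-1` preim (smap_cont (tg_proj (tgf_scheme T W'))) V)
    (b : `O_(sdom W' : scheme) V) :
  sharp (scheme_comp (smor (tgf_map T h)) k) OV (tg_diff (tgf_scheme T W') b)
  = sharp k OU (tg_diff (tgf_scheme T W) (sharp (smor h) UV b)).
Proof.
have TUV : preim (smap_cont (tg_proj (tgf_scheme T W))) U `<=`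
       (smor (tgf_map T h) : scheme_hom _ _)
         @^-1` preim (smap_cont (tg_proj (tgf_scheme T W'))) V.
  by move=> x Ux; rewrite /preimage /= tgf_map_proj; apply: UV.
by rewrite (sharp_scheme_comp TUV OU) tgf_mapd.
Qed.

Lemma tangent_base_change_diff (PB : pullbacks Sch)
    (T : forall S : Sch, tangent_functor S) (X Y : Sch) (f : hom X Y)
    (W : slice Y)
    (theta : hom (base_change PB f (tangent (T Y) W))
                 (tangent (T X) (base_change PB f W)))
    (thetaP : is_tangent_base_change theta)
    (N : scheme)
    (k : scheme_hom N (pb PB (sstr (tangent (T Y) W)) f : scheme))
    (V : opens (sdom W : scheme)) (U : opens (pb PB (sstr W) f : scheme))
    (O : opens N)
    (UV : U `<=` (pb1 PB (sstr W) f : scheme_hom _ _) @^-1` V)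
    (OU : O `<=` scheme_comp (smor theta) k
      @^-1` preim (smap_cont (tg_proj (tgf_scheme (T X)
        (base_change PB f W)))) U)
    (OV : O `<=` scheme_comp (pb1 PB (sstr (tangent (T Y) W)) f) k
      @^-1` preim (smap_cont (tg_proj (tgf_scheme (T Y) W))) V)
    (b : `O_(sdom W : scheme) V) :
  sharp (scheme_comp (smor theta) k) OU
    (tg_diff (tgf_scheme (T X) (base_change PB f W))
      (sharp (pb1 PB (sstr W) f : scheme_hom _ _) UV b))
  = sharp (scheme_comp (pb1 PB (sstr (tangent (T Y) W)) f) k) OV
      (tg_diff (tgf_scheme (T Y) W) b).
Proof.
pose th : scheme_hom _ _ := smor theta.
pose qT : scheme_hom _ _ := pb1 PB (sstr (tangent (T Y) W)) f.
pose A1 := preim (smap_cont th)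
  (preim (smap_cont (tg_proj (tgf_scheme (T X) (base_change PB f W)))) U).
pose A2 := preim (smap_cont qT)
  (preim (smap_cont (tg_proj (tgf_scheme (T Y) W))) V).
pose U' := Opens (openI (osetP A1) (osetP A2)).
pose X' := Opens (@openT (X : scheme)).
have U'A1 : U' `<=` A1 by move=> x [].
have U'A2 : U' `<=` A2 by move=> x [].
have OU' : O `<=` k @^-1` U'.
  by move=> x Ox; split; [exact: OU|exact: OV].
rewrite (sharp_scheme_comp U'A1 OU') (sharp_scheme_comp U'A2 OU').
congr (@sharp _ _ k _ _ _ _).
have := tbc_diff thetaP (V' := X') UV (fun x _ => I) U'A1 U'A2
  (fun x _ => I) b 1.
by rewrite !rmorph1 !mulr1.
Qed.

Lemma nat_trans_eq (C D : category) (F G : functor_data C D)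
    (a b : nat_trans F G) : (forall x, a x = b x) -> a = b.
Proof.
case: a b => [a ea] [b eb] /= ab.
have e : a = b by apply: functional_extensionality_dep.
by case: _ / e in eb *; rewrite (Prop_irrelevance ea eb).
Qed.

Lemma comp_inv (C : category) (A1 A2 A3 : C) (a : hom A1 A2) (a' : hom A2 A1)
    (b : hom A2 A3) (b' : hom A3 A2) :
  a \o_c a' = idm A2 -> b \o_c b' = idm A3 ->
  (b \o_c a) \o_c (a' \o_c b') = idm A3.
Proof. by move=> aK bK; rewrite -compA (compA a) aK comp1m. Qed.

Lemma square_inv (C : category) (A B A' B' : C) (a : hom A B) (a' : hom B A)
    (b : hom A' B') (b' : hom B' A') (p : hom A A') (q : hom B B') :
  a \o_c a' = idm B -> b' \o_c b = idm A' -> q \o_c a = b \o_c p ->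
  p \o_c a' = b' \o_c q.
Proof.
by move=> aK bK e; rewrite -[p]comp1m -bK -(compA b') -e -!compA aK compm1.
Qed.

Section Coherence.
Variables (PB : pullbacks Sch) (T : forall S : Sch, tangent_functor S).

Lemma tangent_proj_natural (X : Sch) (W W' : slice X) (h : hom W W') :
  tangent_proj (T X) W' \o_c fmap (tangent (T X)) h
  = h \o_c tangent_proj (T X) W.
Proof. by apply: slice_hom_eq; apply: tgf_mapE. Qed.

Lemma tangent_base_change_sub (X Y : Sch) (f : hom X Y) (W : slice Y)
    (theta : hom (base_change PB f (tangent (T Y) W))
                 (tangent (T X) (base_change PB f W)))
    (thetaP : is_tangent_base_change theta)
    (N : scheme)
    (k : scheme_hom N (pb PB (sstr (tangent (T Y) W)) f : scheme))
    (V : opens (sdom W : scheme)) (U : opens (pb PB (sstr W) f : scheme))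
    (O : opens N) :
  U `<=` (pb1 PB (sstr W) f : scheme_hom _ _) @^-1` V ->
  O `<=` scheme_comp (smor theta) k
      @^-1` preim (smap_cont (tg_proj (tgf_scheme (T X)
        (base_change PB f W)))) U ->
  O `<=` scheme_comp (pb1 PB (sstr (tangent (T Y) W)) f) k
      @^-1` preim (smap_cont (tg_proj (tgf_scheme (T Y) W))) V.
Proof.
move=> UV OU x /OU/UV; rewrite /preimage /=; set y := k x; move=> Vx.
have e : pb1 PB (sstr W) f
    \o_c smor (tangent_proj (T X) (base_change PB f W) \o_c theta)
   = smor (tangent_proj (T Y) W) \o_c pb1 PB (sstr (tangent (T Y) W)) f.
  by rewrite (tbc_proj thetaP); apply: pb_lift1.
have := congr1 (fun h : scheme_hom _ _ => h y) e.
by move=> /= <-.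
Qed.

Lemma tangent_base_change_comp (X Y Z : Sch) (f : hom X Y) (g : hom Y Z)
    (W : slice Z)
    (tg : hom (base_change PB g (tangent (T Z) W))
              (tangent (T Y) (base_change PB g W)))
    (tf : hom (base_change PB f (tangent (T Y) (base_change PB g W)))
              (tangent (T X) (base_change PB f (base_change PB g W))))
    (tgf : hom (base_change PB (g \o_c f) (tangent (T Z) W))
               (tangent (T X) (base_change PB (g \o_c f) W))) :
  is_tangent_base_change tg -> is_tangent_base_change tf ->
  is_tangent_base_change tgf ->
  fmap (tangent (T X)) (phi PB f g W) \o_c (tf \o_c fmap (base_change PB f) tg)
  = tgf \o_c phi PB f g (tangent (T Z) W).
Proof.
move=> tgP tfP tgfP; apply: slice_hom_eq.
apply: (@tangent_hom_pullback_eq PB (sdom W) X Z (sstr W) (g \o_c f)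
  (tgf_scheme (T X) (base_change PB (g \o_c f) W))).
  suff e : tangent_proj (T X) (base_change PB (g \o_c f) W) \o_c
      (fmap (tangent (T X)) (phi PB f g W)
        \o_c (tf \o_c fmap (base_change PB f) tg))
    = tangent_proj (T X) (base_change PB (g \o_c f) W) \o_c
      (tgf \o_c phi PB f g (tangent (T Z) W)).
    exact: (congr1 (fun h => smor h) e).
  rewrite compA tangent_proj_natural -compA [in LHS](compA (tangent_proj _ _)).
  rewrite (tbc_proj tfP) -fmap_comp (tbc_proj tgP).
  rewrite [RHS]compA (tbc_proj tgfP).
  by rewrite [RHS](naturality (phi PB f g)).
move=> U U' O UU uO vO b /=.
pose phiW : scheme_hom _ _ := smor (phi PB f g W).
pose p1g : scheme_hom _ _ := pb1 PB (sstr W) g.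
pose p1f : scheme_hom _ _ := pb1 PB (sstr (base_change PB g W)) f.
pose k : scheme_hom _ _ := smor (tf \o_c fmap (base_change PB f) tg).
have phiE : scheme_comp (pb1 PB (sstr W) (g \o_c f)) phiW
    = scheme_comp p1g p1f.
  exact: (pb_lift1 PB (phi_subproof PB f g W)).
pose U1 := preim (smap_cont phiW) U'.
pose U2 := preim (smap_cont p1g) U.
have U12 : U1 `<=` p1f @^-1` U2.
  move=> x /UU.
  have /= e := congr1 (fun h : scheme_hom _ _ => h x) phiE.
  by rewrite /preimage /= -e.
have kU1 : O `<=` k @^-1` preim (smap_cont (tg_proj (tgf_scheme (T X) _))) U1.
  by move=> x /uO; rewrite /preimage /= tgf_map_proj.
rewrite [LHS](tgf_map_diff (k := k) (@subset_refl _ U1) kU1 uO).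
have bE : sharp phiW (@subset_refl _ U1)
    (sharp (pb1 PB (sstr W) (g \o_c f) : scheme_hom _ _) UU b)
   = sharp p1f U12 (sharp p1g (@subset_refl _ U2) b).
  have sub : U1 `<=` scheme_comp (pb1 PB (sstr W) (g \o_c f)) phiW @^-1` U.
    by move=> x /UU.
  rewrite -(sharp_scheme_comp _ _ sub).
  have sub' : U1 `<=` scheme_comp p1g p1f @^-1` U by rewrite -phiE.
  rewrite -(sharp_scheme_comp _ _ sub').
  exact: eq_sharp.
rewrite [X in tg_diff _ X]bE.
pose h1 : scheme_hom _ _ := smor (fmap (base_change PB f) tg).
pose TZW : slice Z := tangent (T Z) W.
pose q : scheme_hom _ _ := pb1 PB (sstr (base_change PB g TZW)) f.
pose phiT : scheme_hom _ _ := smor (phi PB f g TZW).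
have O1 := tangent_base_change_sub tfP (k := h1) U12 kU1.
rewrite [LHS](tangent_base_change_diff tfP (k := h1) U12 kU1 O1).
have e1 : scheme_comp (pb1 PB (sstr (tangent (T Y) (base_change PB g W))) f) h1
  = scheme_comp (smor tg) q := pb_lift1 PB (bc_hom_subproof PB f tg).
have O2 : O `<=` scheme_comp (smor tg) q @^-1`
    preim (smap_cont (tg_proj (tgf_scheme (T Y) (base_change PB g W)))) U2.
  by rewrite -e1.
rewrite (eq_sharp O1 O2 _ e1).
have O3 := tangent_base_change_sub tgP (k := q) (@subset_refl _ U2) O2.
rewrite [LHS](tangent_base_change_diff tgP (k := q) (@subset_refl _ U2) O2 O3).
have O4 := tangent_base_change_sub tgfP (k := phiT) UU vO.
rewrite [RHS](tangent_base_change_diff tgfP (k := phiT) UU vO O4).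
by apply: eq_sharp; rewrite [RHS](pb_lift1 PB (phi_subproof PB f g TZW)).
Qed.

Lemma tangent_base_change_id (X : Sch) (W : slice X)
    (theta : hom (base_change PB (idm X) (tangent (T X) W))
                 (tangent (T X) (base_change PB (idm X) W))) :
  is_tangent_base_change theta ->
  fmap (tangent (T X)) (unitor PB X W)
  = theta \o_c unitor PB X (tangent (T X) W).
Proof.
move=> thetaP; apply: slice_hom_eq.
apply: (@tangent_hom_pullback_eq PB (sdom W) X X (sstr W) (idm X)
  (tgf_scheme (T X) (base_change PB (idm X) W))).
  suff e : tangent_proj (T X) (base_change PB (idm X) W)
      \o_c fmap (tangent (T X)) (unitor PB X W)
    = tangent_proj (T X) (base_change PB (idm X) W)
      \o_c (theta \o_c unitor PB X (tangent (T X) W)).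
    exact: (congr1 (fun h => smor h) e).
  rewrite tangent_proj_natural [RHS]compA (tbc_proj thetaP).
  by rewrite [RHS](naturality (unitor PB X)).
move=> U U' O UU uO vO b.
pose eta : scheme_hom _ _ := smor (unitor PB X W).
pose etaT : scheme_hom _ _ := smor (unitor PB X (tangent (T X) W)).
have etaE : scheme_comp (pb1 PB (sstr W) (idm X)) eta = scheme_id _
  := pb_lift1 PB (unitor_subproof W).
have etaTE : scheme_comp (pb1 PB (sstr (tangent (T X) W)) (idm X)) etaT
  = scheme_id _ := pb_lift1 PB (unitor_subproof (tangent (T X) W)).
have O4 := tangent_base_change_sub thetaP (k := etaT) UU vO.
rewrite [RHS](tangent_base_change_diff thetaP (k := etaT) UU vO O4).
pose U1 := preim (smap_cont eta) U'.
have O1 : O `<=` scheme_id _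
    @^-1` preim (smap_cont (tg_proj (tgf_scheme (T X) W))) U1.
  by move=> x /uO; rewrite /preimage /= tgf_map_proj.
have U1U : U1 `<=` scheme_id (sdom W) @^-1` U.
  move=> x /UU.
  have /= e := congr1 (fun h : scheme_hom _ _ => h x) etaE.
  by rewrite /preimage /= e.
have sub : U1 `<=` scheme_comp (pb1 PB (sstr W) (idm X)) eta @^-1` U.
  by move=> x /UU.
have sub' : O `<=` scheme_comp
    (smor (tgf_map (T X) (unitor PB X W))) (scheme_id _)
    @^-1` preim (smap_cont
      (tg_proj (tgf_scheme (T X) (base_change PB (idm X) W)))) U' := uO.
transitivity (sharp _ sub'
  (tg_diff (tgf_scheme (T X) (base_change PB (idm X) W))
    (sharp (pb1 PB (sstr W) (idm X) : scheme_hom _ _) UU b))).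
  by apply: eq_sharp; rewrite scheme_compm1.
rewrite [LHS](tgf_map_diff (@subset_refl _ U1) O1 sub').
rewrite -(sharp_scheme_comp _ _ sub) (eq_sharp sub U1U b etaE).
have O4' : O `<=` scheme_id _
    @^-1` preim (smap_cont (tg_proj (tgf_scheme (T X) W))) U.
  by rewrite -etaTE.
rewrite (eq_sharp O4 O4' _ etaTE) /= -tg_diff_res.
by rewrite (res_comp _ _ O4').
Qed.

End Coherence.

Theorem proposition6p16 (PB : pullbacks Sch)
    (T : forall S : Sch, tangent_functor S)
    (fT : forall (X Y : Sch) (f : hom X Y),
      nat_iso (base_change PB f \o_F tangent (T Y))
              (tangent (T X) \o_F base_change PB f))
    (fT_canonical : forall (X Y : Sch) (f : hom X Y) (W : slice Y),
      is_tangent_base_change (fT X Y f W)) :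
  (forall (X Y Z : Sch) (f : hom X Y) (g : hom Y Z),
    (phi PB f g \wr tangent (T Z))
      \o_v ((base_change PB f \wl iso_inv (fT Y Z g))
             \o_v (iso_inv (fT X Y f) \wr base_change PB g))
    = iso_inv (fT X Z (g \o_c f)) \o_v (tangent (T X) \wl phi PB f g))
  /\
  pseudonatural (P := slice_pf PB) (Q := slice_pf PB)
    (t := fun X : Sch => tangent (T X))
    (fun (X Y : Sch) (f : hom X Y) => iso_inv (fT X Y f)).
Proof.
have comp_coh (X Y Z : Sch) (f : hom X Y) (g : hom Y Z) :
    (phi PB f g \wr tangent (T Z))
      \o_v ((base_change PB f \wl iso_inv (fT Y Z g))
             \o_v (iso_inv (fT X Y f) \wr base_change PB g))
    = iso_inv (fT X Z (g \o_c f)) \o_v (tangent (T X) \wl phi PB f g).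
  apply: nat_trans_eq => W.
  apply: (square_inv _ (iso_fwdK (fT X Z (g \o_c f)) W)
    (tangent_base_change_comp (fT_canonical Y Z g W)
      (fT_canonical X Y f (base_change PB g W))
      (fT_canonical X Z (g \o_c f) W))).
  apply: comp_inv (iso_invK (fT X Y f) (base_change PB g W)).
  rewrite -[RHS](fmap_id (base_change PB f)) -(iso_invK (fT Y Z g) W).
  by rewrite [RHS]fmap_comp.
split=> //; split=> // [X Y f W|X].
  exists (fT X Y f W).
  by split; [exact: (iso_invK (fT X Y f))|exact: (iso_fwdK (fT X Y f))].
apply: nat_trans_eq => W.
have e := tangent_base_change_id (fT_canonical X X (idm X) W).
rewrite -[RHS]comp1m -[X in _ = X \o_c _](iso_fwdK (fT X X (idm X)) W).
by rewrite -[RHS]compA -[X in _ = _ \o_c X]e.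
Qed.
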